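(* Let $G$ be a bridgeless cubic graph with $m$ edges. If $\tau(G)\le 4$ then $scc(G)=\frac{4}{3}m$.
   Context: The perfect matching index $\tau(G)$ of a bridgeless cubic graph is the smallest integer $k$ such that there exist perfect matchings $M_1,\dots,M_k$ of $G$ whose union is $E(G)$. A cycle cover of $G$ is a collection of cycles covering every edge at least once; its length is the sum of the lengths of its cycles, and $scc(G)$ is the minimum length of a cycle cover of $G$. *)

(* Defs.v *)
From mathcomp Require Import all_boot all_order all_algebra.

Set Implicit Arguments.
Unset Strict Implicit.
Unset Printing Implicit Defensive.

(* Finite multigraphs: parallel edges and loops are allowed.  The pair [ends e]
   stores the two ends of the undirected edge [e] in an arbitrary order. *)
Record graph := Graph {
  vertex : finType;
  edge : finType;
  ends : edge -> vertex * vertex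
}.

Section GraphNotions.

Variable G : graph.

(* A subgraph is given by its edge set [A]; a loop contributes 2 to [deg]. *)
Definition deg (A : {set edge G}) (v : vertex G) : nat :=
  #|[set e in A | (ends e).1 == v]| + #|[set e in A | (ends e).2 == v]|.

Definition adj (A : {set edge G}) : rel (vertex G) :=
  fun u v => [exists e in A, (ends e == (u, v)) || (ends e == (v, u))].

Definition cubic : Prop := forall v : vertex G, deg setT v = 3.

Definition components (A : {set edge G}) : nat := n_comp (adj A) predT.

Definition bridge (e : edge G) : bool :=
  components setT < components [set~ e].

Definition bridgeless : Prop := forall e : edge G, ~~ bridge e.

Definition perfect_matching (M : {set edge G}) : Prop :=
  forall v : vertex G, deg M v = 1.

(* Edge sets of connected 2-regular subgraphs; the vertices of the subgraph
   are those of nonzero degree. *)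
Definition is_cycle (C : {set edge G}) : Prop :=
  [/\ C != set0,
      forall v, deg C v != 0 -> deg C v = 2
    & forall u v, deg C u != 0 -> deg C v != 0 -> connect (adj C) u v].

Definition covered_by_perfect_matchings (k : nat) : Prop :=
  exists M : 'I_k -> {set edge G},
    (forall i, perfect_matching (M i)) /\ \bigcup_i M i = setT.

Definition cycle_cover (F : seq {set edge G}) : Prop :=
  (forall C, C \in F -> is_cycle C) /\
  (forall e : edge G, exists2 C, C \in F & e \in C).

Definition cover_length (F : seq {set edge G}) : nat := \sum_(C <- F) #|C|.

Definition has_cycle_cover_of_length (l : nat) : Prop :=
  exists2 F, cycle_cover F & cover_length F = l.

End GraphNotions.

Definition is_least (P : nat -> Prop) (n : nat) : Prop :=
  P n /\ forall k, P k -> n <= k.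

(* tau(G) = k *)
Definition is_perfect_matching_index (G : graph) (k : nat) : Prop :=
  is_least (covered_by_perfect_matchings G) k.

(* scc(G) = l *)
Definition is_scc (G : graph) (l : nat) : Prop :=
  is_least (has_cycle_cover_of_length G) l.

(* Main.v *)
Require Import Defs.
From mathcomp Require Import all_boot all_order all_algebra.
From mathcomp Require Import zify ring.

(** At every vertex the degrees of the cycles of a cover add up to an even
    number that is at least 3, hence at least 4; so a cover has length at least
    [2 * #|V| = 4/3 m].  Conversely, let [M_0, ..., M_3] be perfect matchings
    covering the edges, and for each [i] let [C_i] be the complement of the
    symmetric difference of the three matchings other than [M_i].  All degrees
    of [C_i] are even and at most 3, so [C_i] is a disjoint union of cycles.
    Every edge lies in one or two of the matchings, and it lies in as many of
    the [C_i] as of the [M_i]; hence the [C_i] cover all edges and their sizes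
    add up to four times [#|V| / 2]. *)

Set Implicit Arguments.
Unset Strict Implicit.
Unset Printing Implicit Defensive.

(** * Degree counting and the lower bound on the length of a cycle cover *)

Section Degrees.

Variable G : graph.
Implicit Types (A B C M : {set edge G}) (v : vertex G) (e : edge G).

(** The value is 2 for a loop at [v], as in [deg]; degrees thus become weighted sums over edges that
    can be exchanged with other sums. *)
Definition inc v e : nat := ((ends e).1 == v) + ((ends e).2 == v).

Lemma degE A v : deg A v = \sum_(e in A) inc v e.
Proof.
rewrite /deg big_split /= -!sum1_card; congr (_ + _);
  rewrite big_mkcond [RHS]big_mkcond /=; apply: eq_bigr => e _;
  by rewrite inE; case: (e \in A) => //=; case: eqP.
Qed.

Lemma degE_mem A v : deg A v = \sum_e (e \in A) * inc v e.
Proof.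
by rewrite degE big_mkcond; apply: eq_bigr => e _; case: (e \in A); lia.
Qed.

Lemma deg_subset A B v : A \subset B -> deg A v <= deg B v.
Proof.
move=> sAB; rewrite !degE_mem; apply: leq_sum => e _.
rewrite leq_mul2r; apply/orP; right.
by case: (boolP (e \in A)) => // /(subsetP sAB) ->.
Qed.

Lemma deg_setD A B v : B \subset A -> deg A v = deg B v + deg (A :\: B) v.
Proof.
move=> sBA; rewrite !degE_mem -big_split; apply: eq_bigr => e _ /=.
rewrite inE; case: (boolP (e \in B)) => [/(subsetP sBA) ->|_] /=; lia.
Qed.

Lemma sum_inc e : \sum_v inc v e = 2.
Proof.
have sum1 u : \sum_v ((u == v) : nat) = 1.
  by rewrite (bigD1 u) //= eqxx big1 // => v /negPf; rewrite eq_sym => ->.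
by rewrite big_split /= !sum1.
Qed.

Lemma handshake A : \sum_v deg A v = 2 * #|A|.
Proof.
rewrite (eq_bigr _ (fun v _ => degE A v)) exchange_big /=.
by rewrite (eq_bigr _ (fun e _ => sum_inc e)) sum_nat_const mulnC.
Qed.

Lemma card_perfect_matching M : perfect_matching M -> 2 * #|M| = #|vertex G|.
Proof.
by move=> pM; rewrite -handshake (eq_bigr _ (fun v _ => pM v)) sum1_card.
Qed.

Lemma card_edge_cubic : cubic G -> 3 * #|vertex G| = 2 * #|edge G|.
Proof.
move=> hG; rewrite -(cardsT (edge G)) -handshake (eq_bigr _ (fun v _ => hG v)).
by rewrite sum_nat_const mulnC.
Qed.

Lemma deg_cycle_even C v : is_cycle C -> ~~ odd (deg C v).
Proof.
by case=> _ hC _; case: (eqVneq (deg C v) 0) => [->|/hC ->].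
Qed.

Lemma cycle_cover_length_geq (F : seq {set edge G}) :
  cubic G -> cycle_cover F -> 2 * #|vertex G| <= cover_length F.
Proof.
move=> hG [cycF covF].
(* Doubling both sides lets [handshake] turn each [2 * #|C|] into a sum of degrees; after the
   exchange of sums, a total of at least 4 at each vertex suffices. *)
rewrite -(leq_pmul2l (ltn0Sn 1)) mulnA /cover_length big_distrr /=.
rewrite (eq_bigr _ (fun C _ => esym (handshake C))) exchange_big /=.
rewrite mulnC -sum_nat_const; apply: leq_sum => v _.
have ge3 : 3 <= \sum_(C <- F) deg C v.
  rewrite -(hG v) (eq_bigr _ (fun C _ => degE_mem C v)) exchange_big /=.
  rewrite degE_mem; apply: leq_sum => e _.
  have [C CF eC] := covF e.
  by rewrite (big_rem C CF) /= eC inE /=; apply: leq_addr.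
have ev : ~~ odd (\sum_(C <- F) deg C v).
  rewrite big_seq; apply: (big_ind (fun n => ~~ odd n)) => //.
    by move=> x y /negPf ox /negPf oy; rewrite oddD ox oy.
  by move=> C /cycF /deg_cycle_even.
lia.
Qed.

End Degrees.

(** * Splitting 2-regular edge sets into cycles *)

Section CycleDecomposition.

Variable G : graph.
Implicit Types (A C : {set edge G}) (u v : vertex G) (e f : edge G).

Lemma adj_sym A : symmetric (adj A).
Proof. by move=> u v; apply: eq_existsb => e; rewrite orbC. Qed.

Lemma adj_ends A e : e \in A -> adj A (ends e).1 (ends e).2.
Proof. by move=> eA; apply/existsP; exists e; rewrite eA -surjective_pairing eqxx. Qed.

(** Both ends of an edge of [A] lie in one component, so testing only the first end does not depend
    on the arbitrary order in [ends]. *)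
Lemma connect_inc A u v e :
  e \in A -> inc v e != 0 -> connect (adj A) u (ends e).1 = connect (adj A) u v.
Proof.
move=> eA; rewrite /inc; case: (eqVneq (ends e).1 v) => [-> //|_].
case: (eqVneq (ends e).2 v) => [<- _|//].
have cs := sym_connect_sym (@adj_sym A).
by rewrite ![connect _ u _]cs; apply: same_connect => //; apply/connect1/adj_ends.
Qed.

Definition component_edges A u : {set edge G} :=
  [set e in A | connect (adj A) u (ends e).1].

Lemma component_edges_subset A u : component_edges A u \subset A.
Proof. by apply/subsetP => e; rewrite inE => /andP[]. Qed.

(** The edges of [A] at [v] are kept or dropped all together. *)
Lemma deg_component_edges A u v :
  deg (component_edges A u) v = connect (adj A) u v * deg A v.
Proof.
rewrite !degE_mem big_distrr /=; apply: eq_bigr => e _; rewrite inE.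
case: (boolP (e \in A)) => eA /=; last by lia.
have [->|ve] := eqVneq (inc v e) 0; first by lia.
by rewrite (connect_inc _ eA ve) mul1n.
Qed.

(** A path in [A] starting at [u] uses only edges with an end already reached from [u], and these
    all belong to the component. *)
Lemma connect_component_edges A u v :
  connect (adj A) u v -> connect (adj (component_edges A u)) u v.
Proof.
case/connectP => p + ->; elim/last_ind: p => [|p x IHp]; first by rewrite connect0.
rewrite rcons_path last_rcons => /andP[pp ax].
apply: connect_trans (IHp pp) (connect1 _).
have cp : connect (adj A) u (last u p) by apply/connectP; exists p.
case/existsP: ax => f /andP[fA ef]; apply/existsP; exists f; rewrite ef andbT.
rewrite inE fA (connect_inc _ fA (v := last u p)) //.
by rewrite /inc; case/orP: ef => /eqP ->; rewrite /= eqxx // addn1.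
Qed.

Definition two_regular A : Prop := forall v, deg A v != 0 -> deg A v = 2.

Lemma component_edges_cycle A e :
  two_regular A -> e \in A -> is_cycle (component_edges A (ends e).1).
Proof.
move=> rA eA; split.
- by apply/set0Pn; exists e; rewrite inE eA connect0.
- move=> v; rewrite deg_component_edges.
  by case: connect => //; rewrite mul1n; apply: rA.
- have cC w : deg (component_edges A (ends e).1) w != 0 ->
      connect (adj (component_edges A (ends e).1)) (ends e).1 w.
    rewrite deg_component_edges; case: (boolP (connect _ _ w)) => // cw _.
    exact: connect_component_edges.
  move=> u v /cC cu /cC cv; apply: connect_trans cv.
  by rewrite (sym_connect_sym (@adj_sym _)).
Qed.

(** Strong induction on [#|A|]: remove the component of some edge. At each vertex it takes either
    the whole degree or nothing, so the rest stays 2-regular. *)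
Lemma two_regular_cycles A : two_regular A ->
  exists F : seq {set edge G},
    [/\ forall C, C \in F -> is_cycle C,
        forall e, e \in A -> exists2 C, C \in F & e \in C
      & cover_length F = #|A|].
Proof.
have [n] := ubnP #|A|; elim: n A => // n IHn A ltAn rA.
have [->|[e eA]] := set_0Vmem A.
  exists [::]; split=> // [e|]; first by rewrite inE.
  by rewrite /cover_length big_nil cards0.
set C := component_edges A (ends e).1.
have sCA : C \subset A by apply: component_edges_subset.
have cycC : is_cycle C by apply: component_edges_cycle.
have C_gt0 : 0 < #|C| by rewrite card_gt0; case: cycC.
have cA : #|C| + #|A :\: C| = #|A| by rewrite -(cardsID C A) (setIidPr sCA).
have [|v|F [cycF covF lenF]] := IHn (A :\: C); first by lia.
  have := deg_setD v sCA; rewrite deg_component_edges => dA dv.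
  by have := rA v; case: connect dA; lia.
exists (C :: F); split.
- by move=> D; rewrite inE => /orP[/eqP -> //|]; apply: cycF.
- move=> f fA; case: (boolP (f \in C)) => fC.
    by exists C; rewrite // inE eqxx.
  have [|D DF fD] := covF f; first by rewrite inE fC.
  by exists D; rewrite // inE DF orbT.
- by rewrite /cover_length big_cons -/(cover_length F) lenF.
Qed.

Lemma cycle_cover_of_two_regular (s : seq {set edge G}) :
  (forall A, A \in s -> two_regular A) ->
  (forall e, exists2 A, A \in s & e \in A) ->
  has_cycle_cover_of_length G (cover_length s).
Proof.
move=> rs covs.
(* The tail of [s] need not cover every edge, so the induction only covers the edges of the members
   of [s]. *)
suff [F [cycF covF lenF]] : exists F : seq {set edge G},
    [/\ forall C, C \in F -> is_cycle C,
        forall A e, A \in s -> e \in A -> exists2 C, C \in F & e \in C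
      & cover_length F = cover_length s].
  exists F => //; split=> // e.
  by have [A As eA] := covs e; apply: covF eA.
elim: s rs {covs} => [|A s IHs] rs; first by exists [::].
have [|F [cycF covF lenF]] := IHs.
  by move=> B Bs; apply: rs; rewrite inE Bs orbT.
have [|F' [cycF' covF' lenF']] := @two_regular_cycles A.
  by apply: rs; rewrite inE eqxx.
exists (F' ++ F); split.
- by move=> C; rewrite mem_cat => /orP[/cycF'|/cycF].
- move=> B e; rewrite inE => /orP[/eqP -> /covF'|Bs /(covF _ _ Bs)] [C CF eC];
  by exists C; rewrite // mem_cat CF ?orbT.
- move: lenF'; rewrite /cover_length big_cat big_cons /= => ->.
  by congr (_ + _).
Qed.

End CycleDecomposition.

(** Matchings may be repeated, which allows exactly four to be assumed later. *)
Lemma covered_by_perfect_matchings_leq (G : graph) (k k' : nat) :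
  cubic G -> k <= k' ->
  covered_by_perfect_matchings G k -> covered_by_perfect_matchings G k'.
Proof.
move=> hG; case: k => [|k] lek [M [pM covM]].
  (* Without matchings there are no edges, hence by cubicity no vertices, and the empty set is a
     perfect matching. *)
  have noedge : [set: edge G] = set0 by rewrite -covM big_ord0.
  exists (fun=> set0); split=> [i v|].
    by have := hG v; rewrite noedge degE big_set0.
  by rewrite noedge big1.
(* [inord] sends indices out of range to 0, so the surplus matchings are copies of the first one. *)
exists (fun i => M (inord i)); split=> [i|]; first exact: pM.
apply/setP => e; rewrite inE; apply/bigcupP.
have /bigcupP[j _ ej] : e \in \bigcup_i M i by rewrite covM inE.
by exists (widen_ord lek j); rewrite //= inord_val.
Qed.

(** * The cover built from four perfect matchings *)

Section FourPerfectMatchings.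

Variables (G : graph) (M : 'I_4 -> {set edge G}).
Hypotheses (hG : cubic G) (pM : forall i, perfect_matching (M i)).
Hypothesis covM : \bigcup_i M i = setT.

Let mult (e : edge G) : nat := \sum_i (e \in M i).

(** This is [C_i]: an edge is in the symmetric difference of three sets when it lies in an odd
    number of them. *)
Definition parity_class (i : 'I_4) : {set edge G} :=
  [set e | ~~ odd (\sum_(j | j != i) (e \in M j))].

Lemma mult_gt0 e : 0 < mult e.
Proof.
have /bigcupP[j _ ej] : e \in \bigcup_i M i by rewrite covM inE.
by rewrite /mult (bigD1 j) //= ej.
Qed.

(* At an end of [e] the three multiplicities are positive and add up to 4. *)
Lemma mult_leq2 e : mult e <= 2.
Proof.
set v := (ends e).1.
have sum4 : \sum_f mult f * inc v f = 4.
  rewrite (eq_bigr (fun f => \sum_i (f \in M i) * inc v f)); last first.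
    by move=> f _; rewrite big_distrl.
  rewrite exchange_big /= (eq_bigr (fun=> 1)) ?sum1_card ?card_ord // => i _.
  by rewrite -degE_mem; apply: pM.
have sum3 : \sum_f inc v f = 3.
  rewrite -(hG v) degE; apply: eq_bigl => f; by rewrite inE.
have ve : 0 < inc v e by rewrite /inc eqxx.
have rest : \sum_(f | f != e) inc v f <= \sum_(f | f != e) mult f * inc v f.
  by apply: leq_sum => f _; apply: leq_pmull; apply: mult_gt0.
move: sum4 sum3; rewrite (bigD1 e) //= [X in _ -> X = _ -> _](bigD1 e) //=.
nia.
Qed.

(** An edge in [M j] alone lies only in the class of [j]; an edge in exactly two matchings lies in
    the classes of the two other indices. *)
Lemma mult_parity_class e : \sum_i (e \in parity_class i) = mult e.
Proof.
have mE i : (e \in parity_class i) = ~~ odd (mult e - (e \in M i)).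
  by rewrite inE /mult [in RHS](bigD1 i) //= addKn.
rewrite (eq_bigr _ (fun i _ => congr1 nat_of_bool (mE i))).
have := mult_gt0 e; have := mult_leq2 e; rewrite /mult !big_ord_recl !big_ord0.
by do 4!case: (e \in _).
Qed.

Lemma parity_class_two_regular i : two_regular (parity_class i).
Proof.
move=> v.
have le3 : deg (parity_class i) v <= 3.
  by rewrite -(hG v); apply/deg_subset/subsetT.
suff : ~~ odd (deg (parity_class i) v) by lia.
have sum3 : \sum_(j | j != i) deg (M j) v = 3.
  rewrite (eq_bigr _ (fun j _ => pM j v)) sum1_card.
  by have := cardC1 i; rewrite card_ord.
(* The first two terms total 6. The whole sum is even edge by edge: if [n] of the other three
   matchings contain the edge, its coefficient is [n + 1] for odd [n] and [n + 2] for even [n]. *)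
suff : ~~ odd (deg setT v + \sum_(j | j != i) deg (M j) v + deg (parity_class i) v).
  by rewrite hG sum3; lia.
rewrite (eq_bigr _ (fun j _ => degE_mem (M j) v)) exchange_big /= !degE_mem.
rewrite -!big_split /=; apply: (big_ind (fun n => ~~ odd n)) => // [x y|e _].
  by move=> /negPf ox /negPf oy; rewrite oddD ox oy.
rewrite -big_distrl /= !inE -!mulnDl oddM !oddD.
by case: (odd (\sum_(j | j != i) _)).
Qed.

Lemma cover_length_parity_classes :
  cover_length [seq parity_class i | i : 'I_4] = 2 * #|vertex G|.
Proof.
rewrite /cover_length big_image /=.
have card_mem (A : {set edge G}) : #|A| = \sum_e (e \in A).
  by rewrite -sum1_card big_mkcond; apply: eq_bigr => e _; case: (e \in A).
rewrite (eq_bigr _ (fun i _ => card_mem _)) exchange_big /=.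
rewrite (eq_bigr _ (fun e _ => mult_parity_class e)) exchange_big /=.
rewrite (eq_bigr _ (fun i _ => esym (card_mem _))).
apply/eqP; rewrite -(eqn_pmul2l (ltn0Sn 1)) big_distrr /=.
rewrite (eq_bigr _ (fun i _ => card_perfect_matching (pM i))).
by rewrite sum_nat_const card_ord mulnA.
Qed.

Lemma cycle_cover_of_four_perfect_matchings :
  has_cycle_cover_of_length G (2 * #|vertex G|).
Proof.
rewrite -cover_length_parity_classes; apply: cycle_cover_of_two_regular.
  by move=> A /imageP[i _ ->]; apply: parity_class_two_regular.
move=> e; have := mult_gt0 e; rewrite -mult_parity_class lt0n sum_nat_eq0.
case/forallPn => i /=; rewrite eqb0 negbK => ei.
by exists (parity_class i); rewrite // image_f.
Qed.

End FourPerfectMatchings.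

Theorem theorem5p3 (G : graph) (m k : nat)
    (hcubic : cubic G) (hbridgeless : bridgeless G) (hm : #|edge G| = m)
    (htau : is_perfect_matching_index G k) (hk : k <= 4) :
  exists l : nat, is_scc G l /\ (l%:R = 4%:R / 3%:R * m%:R :> rat)%R.
Proof.
have [M [pM covM]] := covered_by_perfect_matchings_leq hcubic hk htau.1.
exists (2 * #|vertex G|); split.
  split; first exact: cycle_cover_of_four_perfect_matchings hcubic pM covM.
  by move=> l [F covF <-]; apply: cycle_cover_length_geq.
(* Counting edge ends gives [3 * #|V| = 2 * m], which converts [2 * #|V|] into four thirds of
   [m]. *)
have := congr1 (fun n => n%:R%R : rat) (card_edge_cubic hcubic).
rewrite hm !GRing.natrM => e.
have -> : (m%:R = 3%:R * #|vertex G|%:R / 2%:R :> rat)%R by rewrite e; field.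
by field.
Qed.
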